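(* Let $(X,\mathcal{T})$ be an $L$-fuzzy topological space and $G\in L^X$. Suppose $\beta(c\wedge d)=\beta(c)\cap\beta(d)$ for all $c,d\in L$. Then the following conditions are equivalent (a condition containing the parenthesized word ''(strong)'' may be read either with or without that word; all resulting conditions are equivalent): (1) $G$ is $L$-fuzzy SP-compact. (2) For any $a\in M(L)$, each strong $\beta_a$-cover $\mathcal{U}\subseteq L^X$ of $G$ with $a\in\beta\big(\bigwedge_{F\in\mathcal{U}}\mathcal{T}_{sp}(F)\big)$ has a finite subfamily $\mathcal{V}$ which is a (strong) $\beta_a$-cover of $G$. (3) For any $a\in M(L)$ and each strong $\beta_a$-cover $\mathcal{U}\subseteq L^X$ of $G$ with $a\in\beta\big(\bigwedge_{F\in\mathcal{U}}\mathcal{T}_{sp}(F)\big)$, there exist a finite subfamily $\mathcal{V}$ of $\mathcal{U}$ and $b\in M(L)$ with $a\in\beta^*(b)$ such that $\mathcal{V}$ is a (strong) $\beta_b$-cover of $G$.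
   Context: $L$ is a completely distributive complete lattice with least element $\bot$, greatest element $\top$ and an order-reversing involution $'$ (a completely distributive De Morgan algebra). $X$ is a nonempty set; $L^X$ is the set of all $L$-subsets (maps $X\to L$), with pointwise order, joins, meets and complement $A'(x)=A(x)'$; $\underline{\bot},\underline{\top}$ are its least and greatest elements. An element $a\in L$ is co-prime if $a\le b\vee c$ implies $a\le b$ or $a\le c$; $M(L)$ is the set of co-prime elements $\neq\bot$. In a complete lattice, $a\ll b$ means: for every subset $D$, $b\le\bigvee D$ implies $a\le d$ for some $d\in D$. $\beta(b)=\{a\in L: a\ll b\}$ and $\beta^*(b)=\beta(b)\cap M(L)$. For $x\in X$, $\lambda\in M(L)$, $x_\lambda\in L^X$ is the $L$-fuzzy point with value $\lambda$ at $x$ and $\bot$ elsewhere; $x_\lambda\ll A$ refers to $\ll$ in $L^X$. An $L$-fuzzy topology on $X$ is a map $\mathcal{T}:L^X\to L$ with $\mathcal{T}(\underline\bot)=\mathcal{T}(\underline\top)=\top$, $\mathcal{T}(A\wedge B)\ge\mathcal{T}(A)\wedge\mathcal{T}(B)$, and $\mathcal{T}(\bigvee_i A_i)\ge\bigwedge_i\mathcal{T}(A_i)$; $(X,\mathcal{T})$ is an $L$-fuzzy topological space. The $L$-fuzzy preopen operator is $$\mathcal{T}_p(A)=\bigwedge_{x_\lambda\ll A}\ \bigvee_{B:\,x_\lambda\ll B}\Big\{\mathcal{T}(B)\wedge\bigwedge_{y_\mu\ll B}\ \bigwedge_{D:\,y_\mu\not\le D\ge A}(\mathcal{T}(D'))'\Big\},$$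 and the $L$-fuzzy Semi-Preopen operator is $$\mathcal{T}_{sp}(A)=\bigvee_{B\le A}\Big\{\mathcal{T}_p(B)\wedge\bigwedge_{x_\lambda\ll A}\ \bigwedge_{D:\,x_\lambda\not\le D\ge B}(\mathcal{T}(D'))'\Big\},$$ where $B,D$ range over $L^X$. $2^{(\mathcal{P})}$ denotes the set of all finite subfamilies of $\mathcal{P}$. $G\in L^X$ is $L$-fuzzy SP-compact in $(X,\mathcal{T})$ if for every family $\mathcal{P}\subseteq L^X$, $$\bigwedge_{F\in\mathcal{P}}\mathcal{T}_{sp}(F)\wedge\bigwedge_{x\in X}\Big(G'(x)\vee\bigvee_{F\in\mathcal{P}}F(x)\Big)\le\bigvee_{\mathcal{Q}\in 2^{(\mathcal{P})}}\bigwedge_{x\in X}\Big(G'(x)\vee\bigvee_{F\in\mathcal{Q}}F(x)\Big).$$ For $a\in L\setminus\{\bot\}$, a family $\mathcal{U}\subseteq L^X$ is a $\beta_a$-cover of $G$ if $a\in\beta(G'(x)\vee\bigvee_{A\in\mathcal{U}}A(x))$ for all $x\in X$, and a strong $\beta_a$-cover of $G$ if $a\in\beta\big(\bigwedge_{x\in X}(G'(x)\vee\bigvee_{A\in\mathcal{U}}A(x))\big)$. *)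

(* Defs.v *)
From HB Require Import structures.
From mathcomp Require Import all_boot all_order.
From mathcomp Require Import boolp classical_sets cardinality.

Set Implicit Arguments.
Unset Strict Implicit.
Unset Printing Implicit Defensive.

Import Order.LTheory.

Local Open Scope classical_set_scope.
Local Open Scope order_scope.

HB.mixin Record isCompleteLattice (d : Order.disp_t) L of Order.TBLattice d L := {
  csup : set L -> L;
  cinf : set L -> L;
  csup_isLub : forall A, isLub A (csup A);
  cinf_isGlb : forall A, lbound A (cinf A) /\ forall b, lbound A b -> b <= cinf A
}.

#[short(type="completeLatticeType")]
HB.structure Definition CompleteLattice (d : Order.disp_t) :=
  { L of Order.TBLattice d L & isCompleteLattice d L }.

HB.mixin Record hasDeMorgan (d : Order.disp_t) L of Order.POrder d L := {
  dmc : L -> L;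
  dmcK : involutive dmc;
  le_dmc : forall a b : L, a <= b -> dmc b <= dmc a
}.

#[short(type="completeDeMorganType")]
HB.structure Definition CompleteDeMorgan (d : Order.disp_t) :=
  { L of CompleteLattice d L & hasDeMorgan d L }.

Notation "\csup_ ( i 'in' D ) F" := (csup [set F | i in D])
  (at level 41, F at level 41, i, D at level 50,
   format "\csup_ ( i  'in'  D )  F") : order_scope.
Notation "\cinf_ ( i 'in' D ) F" := (cinf [set F | i in D])
  (at level 41, F at level 41, i, D at level 50,
   format "\cinf_ ( i  'in'  D )  F") : order_scope.

HB.mixin Record isCompletelyDistributive (d : Order.disp_t) L
    of CompleteLattice d L := {
  cinf_csup_distr : forall (I : Type) (J : I -> Type) (a : forall i, J i -> L),
    \cinf_(i in [set: I]) \csup_(j in [set: J i]) a i j =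
    \csup_(f in [set: forall i, J i]) \cinf_(i in [set: I]) a i (f i)
}.

#[short(type="cdDeMorganType")]
HB.structure Definition CDDeMorgan (d : Order.disp_t) :=
  { L of CompleteDeMorgan d L & isCompletelyDistributive d L }.

(* [boolp] equips [X -> L] with the pointwise lattice structure only; the
   bounds, arbitrary joins and meets, and complement are added here. *)
Section FunBounds.
Variables (X : Type) (d : Order.disp_t) (L : tbLatticeType d).

Definition fun_bot : X -> L := fun=> \bot.
Definition fun_top : X -> L := fun=> \top.

Lemma fun_le0x (A : X -> L) : fun_bot <= A.
Proof. by apply/asboolP => x; exact: le0x. Qed.

Lemma fun_lex1 (A : X -> L) : A <= fun_top.
Proof. by apply/asboolP => x; exact: lex1. Qed.

HB.instance Definition _ := @Order.hasBottom.Build _ (X -> L) _ fun_le0x.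
HB.instance Definition _ := @Order.hasTop.Build _ (X -> L) _ fun_lex1.
End FunBounds.

Section FunComplete.
Variables (X : Type) (d : Order.disp_t) (L : completeLatticeType d).

Definition fun_csup (P : set (X -> L)) : X -> L := fun x => \csup_(A in P) A x.
Definition fun_cinf (P : set (X -> L)) : X -> L := fun x => \cinf_(A in P) A x.

Lemma fun_csup_isLub P : isLub P (fun_csup P).
Proof.
split=> [A PA|B PB]; apply/asboolP => x; rewrite /fun_csup.
  by apply: (csup_isLub _).1; exists A.
by apply: (csup_isLub _).2 => _ [A PA <-]; exact: (asboolP _ (PB A PA)).
Qed.

Lemma fun_cinf_isGlb P :
  lbound P (fun_cinf P) /\ forall B, lbound P B -> B <= fun_cinf P.
Proof.
split=> [A PA|B PB]; apply/asboolP => x; rewrite /fun_cinf.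
  by apply: (cinf_isGlb _).1; exists A.
by apply: (cinf_isGlb _).2 => _ [A PA <-]; exact: (asboolP _ (PB A PA)).
Qed.

HB.instance Definition _ :=
  @isCompleteLattice.Build _ (X -> L) _ _ fun_csup_isLub fun_cinf_isGlb.
End FunComplete.

Section FunDeMorgan.
Variables (X : Type) (d : Order.disp_t) (L : completeDeMorganType d).

Definition fun_dmc (A : X -> L) : X -> L := fun x => dmc (A x).

Lemma fun_dmcK : involutive fun_dmc.
Proof. by move=> A; apply/funext => x; exact: dmcK. Qed.

Lemma le_fun_dmc (A B : X -> L) : A <= B -> fun_dmc B <= fun_dmc A.
Proof.
by move=> /asboolP AB; apply/asboolP => x; apply: le_dmc; exact: AB.
Qed.

HB.instance Definition _ := @hasDeMorgan.Build _ (X -> L) _ fun_dmcK le_fun_dmc.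
End FunDeMorgan.

Section WayBelow.
Variables (d : Order.disp_t) (L : completeLatticeType d).

(* The completely-below relation, written $\ll$: [D] is arbitrary, neither
   directed nor nonempty, so [wbelow a \bot] never holds. *)
Definition wbelow (a b : L) : Prop :=
  forall D : set L, b <= csup D -> exists2 e, D e & a <= e.

Definition beta (b : L) : set L := [set a | wbelow a b].

Definition co_prime (a : L) : Prop :=
  forall b c : L, a <= b `|` c -> a <= b \/ a <= c.

End WayBelow.

(* The set $M(L)$. *)
Definition co_primes (d : Order.disp_t) (L : completeLatticeType d) : set L :=
  [set a | co_prime a /\ a <> \bot].
Arguments co_primes {d} L.

Definition beta_star (d : Order.disp_t) (L : completeLatticeType d) (b : L) :
  set L := (beta b `&` co_primes L)%classic.

Section FuzzyTopology.
Variables (X : Type) (d : Order.disp_t) (L : completeDeMorganType d).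
Implicit Types (T : (X -> L) -> L) (A B D F G : X -> L) (P Q U : set (X -> L)).

Definition fuzzy_point (x : X) (l : L) : X -> L :=
  fun y => if `[< y = x >] then l else \bot.

(* The set of all $x_\lambda$: binders "$x_\lambda \ll A$" below range over the
   fuzzy points themselves instead of over the pairs $(x, \lambda)$. *)
Definition fuzzy_points : set (X -> L) :=
  [set fuzzy_point x l | x in [set: X] & l in co_primes L].

Record fuzzy_topology T : Prop := {
  ftop_bot : T \bot = \top;
  ftop_top : T \top = \top;
  ftop_meet : forall A B, T A `&` T B <= T (A `&` B);
  ftop_csup : forall (I : Type) (A : I -> X -> L),
    \cinf_(i in [set: I]) T (A i) <= T (\csup_(i in [set: I]) A i)
}.

Definition preopen T A : L :=
  \cinf_(p in [set p | fuzzy_points p /\ wbelow p A])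
  \csup_(B in [set B | wbelow p B])
    (T B `&`
     \cinf_(q in [set q | fuzzy_points q /\ wbelow q B])
     \cinf_(D in [set D | ~ (q <= D) /\ A <= D]) dmc (T (dmc D))).

Definition semi_preopen T A : L :=
  \csup_(B in [set B | B <= A])
    (preopen T B `&`
     \cinf_(p in [set p | fuzzy_points p /\ wbelow p A])
     \cinf_(D in [set D | ~ (p <= D) /\ B <= D]) dmc (T (dmc D))).

Definition SP_compact T G : Prop :=
  forall P,
    (\cinf_(F in P) semi_preopen T F) `&`
    (\cinf_(x in [set: X]) (dmc G x `|` \csup_(F in P) F x)) <=
    \csup_(Q in [set Q | finite_set Q /\ (Q `<=` P)%classic])
      \cinf_(x in [set: X]) (dmc G x `|` \csup_(F in Q) F x).

(* Meant for [a <> \bot]. *)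
Definition beta_cover (a : L) G U : Prop :=
  forall x, beta (dmc G x `|` \csup_(A in U) A x) a.

Definition strong_beta_cover (a : L) G U : Prop :=
  beta (\cinf_(x in [set: X]) (dmc G x `|` \csup_(A in U) A x)) a.

End FuzzyTopology.

(* Main.v *)
(* Write a << b for [wbelow a b]. Complete distributivity makes every b the join
   of the elements << b. When << is stable under binary meets, coprime elements
   can be written down explicitly: given w << b', the set J = {x | w << x'} is
   closed under binary joins, and its complement under arbitrary meets, so the
   meet p of that complement satisfies p <= x iff x is not in J, and p is
   coprime. Hence every b is the join of beta^*(b), and << can be interpolated
   by coprime elements. All implications of the theorem follow by inserting a
   coprime between a and the two meets that bound it. *)
Require Import Defs.
From mathcomp Require Import all_boot all_order.
From mathcomp Require Import boolp classical_sets cardinality.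

Local Open Scope classical_set_scope.
Local Open Scope order_scope.


Set Implicit Arguments.
Unset Strict Implicit.
Unset Printing Implicit Defensive.

Import Order.LTheory.

Section CompleteLattices.
Variables (d : Order.disp_t) (L : completeLatticeType d).
Implicit Types (a b c : L) (D : set L).

Lemma csup_ub D c : D c -> c <= csup D.
Proof. exact: (csup_isLub D).1. Qed.

Lemma csup_le D b : (forall c, D c -> c <= b) -> csup D <= b.
Proof. exact: (csup_isLub D).2. Qed.

Lemma cinf_lb D c : D c -> cinf D <= c.
Proof. exact: (cinf_isGlb D).1. Qed.

Lemma cinf_ge D b : (forall c, D c -> b <= c) -> b <= cinf D.
Proof. exact: (cinf_isGlb D).2. Qed.

Lemma wbelow_le a b : wbelow a b -> a <= b.
Proof.
move=> ab; have [|_ -> //] := ab [set b].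
exact: csup_ub.
Qed.

Lemma le_wbelow a b c : a <= b -> wbelow b c -> wbelow a c.
Proof.
move=> ab bc D /bc[e De be].
by exists e => //; exact: le_trans be.
Qed.

Lemma wbelow_le_trans a b c : wbelow a b -> b <= c -> wbelow a c.
Proof. by move=> ab bc D cD; apply: ab; exact: le_trans cD. Qed.

End CompleteLattices.

Lemma dmc_le_csup (d : Order.disp_t) (L : completeDeMorganType d) (C : set L) :
  dmc (cinf C) <= \csup_(c in C) dmc c.
Proof.
rewrite -[leRHS]dmcK; apply/le_dmc/cinf_ge => c Cc.
by rewrite -[leRHS]dmcK; apply/le_dmc/csup_ub; exists c.
Qed.

Lemma dmc_meet_le (d : Order.disp_t) (L : completeDeMorganType d) (x y : L) :
  dmc x `&` dmc y <= dmc (x `|` y).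
Proof.
rewrite -[leLHS]dmcK; apply/le_dmc; rewrite leUx.
by rewrite -{1}[x]dmcK -{2}[y]dmcK !le_dmc ?leIl ?leIr.
Qed.

Section CompletelyDistributive.
Variables (d : Order.disp_t) (L : cdDeMorganType d).
Implicit Types (a b c p u : L) (D : set L).

(* Distribute the meet over all D with b <= csup D of the joins csup D: the
   meet of the values of a choice function is completely below b. *)
Lemma le_csup_beta b : b <= csup (beta b).
Proof.
pose I := {D : set L | b <= csup D}.
pose J (i : I) := {e : L | sval i e}.
apply: (@le_trans _ _ (\cinf_(i in [set: I]) \csup_(j in [set: J i]) sval j)).
  apply: cinf_ge => _ [[D bD] _ <-]; apply: (le_trans bD).
  by apply: csup_le => e De; apply: csup_ub; exists (exist _ e De).
rewrite cinf_csup_distr; apply: csup_le => _ [f _ <-]; apply: csup_ub => D bD.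
exists (sval (f (exist _ D bD))); first exact: (svalP (f (exist _ D bD))).
by apply: cinf_lb; exists (exist _ D bD).
Qed.

(** Each [e] in [D] is the join of the elements completely below it, so these elements, taken over
    all of [D], have a join above [csup D]; [a] lies below one of them. *)
Lemma wbelow_csup a D : wbelow a (csup D) -> exists2 e, D e & wbelow a e.
Proof.
move=> aD; have [|c [e De ce] ac] := aD [set c | exists2 e, D e & wbelow c e].
  apply: csup_le => e De; apply: le_trans (le_csup_beta e) _.
  by apply: csup_le => c ce; apply: csup_ub; exists e.
by exists e => //; exact: le_wbelow ce.
Qed.

Lemma not_le_wbelow b u : ~ b <= u -> exists2 c, wbelow c b & ~ c <= u.
Proof.
move=> bu; apply: contrapT => h; apply: bu; apply: le_trans (le_csup_beta b) _.
apply: csup_le => c cb; apply: contrapT => cu.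
by apply: h; exists c.
Qed.

Lemma co_prime_separation b u :
  (forall a c e : L, wbelow a c -> wbelow a e -> wbelow a (c `&` e)) ->
  ~ b <= u -> exists p, [/\ co_primes L p, p <= b & ~ p <= u].
Proof.
move=> betaI bu.
(* The first property of [w] will give [~ p <= u], the second [p <= b]. *)
have [w wu wb] : exists2 w, wbelow w (dmc u) & ~ w <= dmc b.
  by apply: not_le_wbelow => /le_dmc; rewrite !dmcK.
pose p := cinf [set x | ~ wbelow w (dmc x)].
have pP x : ~ p <= x <-> wbelow w (dmc x).
  split=> [px|wx px]; first by apply: contrapT => wx; apply: px; exact: cinf_lb.
  (* If [p <= x], then [dmc x] is below the join of the complements of the elements defining [p], so
     [w] is completely below one of these, which their choice forbids. *)
  have /wbelow_csup[_ [c wc <-] //] :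
      wbelow w (\csup_(c in [set x | ~ wbelow w (dmc x)]) dmc c).
    apply: wbelow_le_trans _ (dmc_le_csup _).
    exact: wbelow_le_trans wx (le_dmc _ _ px).
have pu : ~ p <= u by apply/pP.
exists p; split=> //; last by apply: cinf_lb => /wbelow_le.
split=> [x y pxy|p0]; last by apply: pu; rewrite p0 le0x.
apply: contrapT => /not_orP[/pP wx /pP wy].
suff /pP : wbelow w (dmc (x `|` y)) by [].
by apply: wbelow_le_trans _ (dmc_meet_le x y); exact: betaI.
Qed.

Section MeetStable.
Hypothesis betaI :
  forall a c e : L, wbelow a c -> wbelow a e -> wbelow a (c `&` e).

(** Otherwise some [c] completely below [b] is not below the join, and a coprime [p <= c] separating
    [c] from the join would itself belong to [beta_star b]. *)
Lemma le_csup_beta_star b : b <= csup (beta_star b).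
Proof.
apply: contrapT => /not_le_wbelow[c cb].
move=> /(co_prime_separation betaI)[p [p_prime pc]]; apply.
by apply: csup_ub; split=> //; exact: le_wbelow cb.
Qed.

Lemma wbelow_interpolation a b :
  wbelow a b -> exists c, [/\ co_primes L c, wbelow a c & wbelow c b].
Proof.
move=> ab.
have /wbelow_csup[c [cb c_prime] ac] := wbelow_le_trans ab (le_csup_beta_star b).
by exists c.
Qed.

End MeetStable.
End CompletelyDistributive.

Section Covers.
Variables (X : Type) (d : Order.disp_t) (L : completeDeMorganType d).
Implicit Types (a : L) (G : X -> L) (U : set (X -> L)).

Lemma strong_beta_cover_beta_cover a G U :
  strong_beta_cover a G U -> beta_cover a G U.
Proof. by move=> aU x; apply: wbelow_le_trans aU (cinf_lb _); exists x. Qed.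

(** Only [<=] survives the meet over all points; interpolating a coprime beforehand restores the
    strict relation. *)
Lemma beta_cover_le a G U : beta_cover a G U ->
  a <= \cinf_(x in [set: X]) (dmc G x `|` \csup_(A in U) A x).
Proof. by move=> aU; apply: cinf_ge => _ [x _ <-]; exact: wbelow_le (aU x). Qed.

End Covers.

Theorem theorem4p3 (d : Order.disp_t) (L : cdDeMorganType d) (X : Type)
    (X_neq0 : inhabited X) (T : (X -> L) -> L) (T_ftop : fuzzy_topology T)
    (G : X -> L)
    (beta_meet : forall c e : L, beta (c `&` e) = (beta c `&` beta e)%classic) :
  [<->
    (* (1) *)
    SP_compact T G;
    (* (2), cover *)
    forall a : L, co_primes L a -> forall U : set (X -> L),
      strong_beta_cover a G U ->
      beta (\cinf_(F in U) semi_preopen T F) a ->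
      exists V : set (X -> L),
        [/\ finite_set V, (V `<=` U)%classic & beta_cover a G V];
    (* (2), strong cover *)
    forall a : L, co_primes L a -> forall U : set (X -> L),
      strong_beta_cover a G U ->
      beta (\cinf_(F in U) semi_preopen T F) a ->
      exists V : set (X -> L),
        [/\ finite_set V, (V `<=` U)%classic & strong_beta_cover a G V];
    (* (3), cover *)
    forall a : L, co_primes L a -> forall U : set (X -> L),
      strong_beta_cover a G U ->
      beta (\cinf_(F in U) semi_preopen T F) a ->
      exists (V : set (X -> L)) (b : L),
        [/\ finite_set V, (V `<=` U)%classic, co_primes L b, beta_star b a
          & beta_cover b G V];
    (* (3), strong cover *)
    forall a : L, co_primes L a -> forall U : set (X -> L),
      strong_beta_cover a G U ->
      beta (\cinf_(F in U) semi_preopen T F) a ->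
      exists (V : set (X -> L)) (b : L),
        [/\ finite_set V, (V `<=` U)%classic, co_primes L b, beta_star b a
          & strong_beta_cover b G V]
  ].
Proof.
have betaI (a c e : L) : wbelow a c -> wbelow a e -> wbelow a (c `&` e).
  by move=> ac ae; rewrite -[wbelow _ _]/(beta (c `&` e) a) beta_meet.
have interp (a b c : L) : wbelow a b -> wbelow a c ->
    exists e, [/\ co_primes L e, wbelow a e, wbelow e b & wbelow e c].
  move=> ab ac.
  have /(wbelow_interpolation betaI)[e [e_prime ae ebc]] :
    wbelow a (b `&` c) by exact: betaI.
  exists e; split=> //; apply: wbelow_le_trans ebc _; [exact: leIl|exact: leIr].
tfae=> [compG|cov|cov|cov|cov].
- move=> a a_prime U aU aT.
  (* Being completely below the join over finite subfamilies selects a single one. *)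
  have /wbelow_csup[_ [V [Vfin VU] <-] aV] :=
    wbelow_le_trans (betaI _ _ _ aT aU) (compG U).
  by exists V; split=> //; exact: strong_beta_cover_beta_cover.
- move=> a a_prime U aU aT.
  have [b [b_prime ab bU bT]] := interp _ _ _ aU aT.
  have [V [Vfin VU bV]] := cov b b_prime U bU bT.
  exists V; split=> //; exact: wbelow_le_trans ab (beta_cover_le bV).
- move=> a a_prime U aU aT.
  have [b [b_prime ab bU bT]] := interp _ _ _ aU aT.
  have [V [Vfin VU bV]] := cov b b_prime U bU bT.
  by exists V, b; split=> //; exact: strong_beta_cover_beta_cover.
- move=> a a_prime U aU aT.
  (* The interpolant [c] is the new level: the level [b] obtained from [cov] only gives a plain
     cover, but [c] is completely below [b]. *)
  have [c [c_prime ac cU cT]] := interp _ _ _ aU aT.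
  have [V [b [Vfin VU b_prime [cb _] bV]]] := cov c c_prime U cU cT.
  by exists V, c; split=> //; exact: wbelow_le_trans cb (beta_cover_le bV).
(* It suffices to bound each coprime completely below the left-hand side. *)
- move=> U; apply: le_trans (le_csup_beta_star betaI _) _.
  apply: csup_le => a [aTU a_prime].
  have [V [b [Vfin VU b_prime [ab _] bV]]] := cov a a_prime U
    (wbelow_le_trans aTU (leIr _ _)) (wbelow_le_trans aTU (leIl _ _)).
  apply: le_trans (wbelow_le ab) _; apply: le_trans (wbelow_le bV) _.
  by apply: csup_ub; exists V.
Qed.
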